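(* Let $G$ be a connected $(P_5,C_5)$-free graph of order $n$ with minimum degree $\delta(G)\geq 3$. Then $rx_3(G)\leq \frac{11}{16}n+3$.
   Context: All graphs are finite, simple and undirected. $P_5$ is the path on $5$ vertices and $C_5$ is the cycle on $5$ vertices; a graph is $(P_5,C_5)$-free if it contains neither $P_5$ nor $C_5$ as an induced subgraph. Edge colorings are arbitrary (adjacent edges may receive the same color). In an edge-colored graph $G$, a tree $T\subseteq G$ (a subgraph that is a tree) is a rainbow tree if no two edges of $T$ have the same color. For a connected graph $G$ of order $n\ge 3$, a $3$-rainbow coloring of $G$ is an edge coloring such that for every set $S$ of $3$ vertices of $G$ there is a rainbow tree $T$ in $G$ with $S\subseteq V(T)$. The $3$-rainbow index $rx_3(G)$ is the minimum number of colors in a $3$-rainbow coloring of $G$. *)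

(* Defs.v *)
From mathcomp Require Import all_boot.
From mathcomp Require Import boolp.

Set Implicit Arguments.
Unset Strict Implicit.
Unset Printing Implicit Defensive.

Record sgraph := SGraph {
  svertex :> finType;
  sedge : rel svertex;
  sedge_sym : symmetric sedge;
  sedge_irr : irreflexive sedge }.

Definition P5_adj : rel 'I_5 := fun i j => (i.+1 == j) || (j.+1 == i).

Definition C5_adj : rel 'I_5 :=
  fun i j => (i.+1 %% 5 == j) || (j.+1 %% 5 == i).

Lemma P5_adj_sym : symmetric P5_adj.
Proof. by move=> i j; rewrite /P5_adj orbC. Qed.

Lemma P5_adj_irr : irreflexive P5_adj.
Proof. by move=> [[|[|[|[|[|i]]]]] // Hi]. Qed.

Lemma C5_adj_sym : symmetric C5_adj.
Proof. by move=> i j; rewrite /C5_adj orbC. Qed.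

Lemma C5_adj_irr : irreflexive C5_adj.
Proof. by move=> [[|[|[|[|[|i]]]]] // Hi]. Qed.

Definition P5 : sgraph := SGraph P5_adj_sym P5_adj_irr.
Definition C5 : sgraph := SGraph C5_adj_sym C5_adj_irr.

Definition induced_subgraph (H G : sgraph) : Prop :=
  exists f : H -> G, injective f /\ {mono f : x y / sedge x y}.

Definition degree (G : sgraph) (x : G) : nat := #|[set y | sedge x y]|.

(* Every degree is less than [#|G|], so the default value of the minimum only
   matters for the graph without vertices, where it is 0. *)
Definition min_degree (G : sgraph) : nat :=
  \big[minn/#|G|]_(x : G) degree x.

Definition edges (G : sgraph) : {set {set G}} :=
  [set [set p.1; p.2] | p in [set p : G * G | sedge p.1 p.2]].

(* When [r] only relates elements of [V], this says that the graph with
   vertex set [V] and adjacency [r] is connected. *)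
Definition connected_on (T : finType) (V : {set T}) (r : rel T) : Prop :=
  V != set0 /\ {in V &, forall x y, connect r x y}.

Definition connected (G : sgraph) : Prop := connected_on [set: G] (@sedge G).

Definition acyclic (T : finType) (r : rel T) : Prop :=
  forall c : seq T, 2 < size c -> ~ ucycle r c.

Definition adj_of (T : finType) (F : {set {set T}}) : rel T :=
  fun x y => [set x; y] \in F.

(* The subgraph with vertex set [V] and edge set [F] is a tree. *)
Record subtree (G : sgraph) (V : {set G}) (F : {set {set G}}) : Prop :=
  Subtree {
    subtree_edges : F \subset edges G;
    subtree_ends : cover F \subset V;
    subtree_conn : connected_on V (adj_of F);
    subtree_acyc : acyclic (adj_of F) }.

(* An edge coloring is a function on all sets of vertices; its values outside
   [edges G] play no role. *)
Definition rainbow_tree (G : sgraph) (k : nat) (c : {set G} -> 'I_k)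
    (V : {set G}) (F : {set {set G}}) : Prop :=
  subtree V F /\ {in F &, injective c}.

Definition rainbow3_coloring (G : sgraph) (k : nat) (c : {set G} -> 'I_k) :
    Prop :=
  forall S : {set G}, #|S| = 3 ->
    exists V F, rainbow_tree c V F /\ S \subset V.

Definition rainbow3_colorable (G : sgraph) (k : nat) : Prop :=
  exists c : {set G} -> 'I_k, rainbow3_coloring c.

Lemma adj_of_sym (T : finType) (F : {set {set T}}) : symmetric (adj_of F).
Proof. by move=> x y; rewrite /adj_of setUC. Qed.

Lemma adj_of_edges (G : sgraph) : adj_of (edges G) =2 @sedge G.
Proof.
move=> x y; apply/imsetP/idP => [[[a b]] | xy]; last first.
  by exists (x, y); rewrite ?inE.
rewrite inE /= => ab /setP exy.
have := exy x; have := exy y; have := exy a; have := exy b.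
rewrite !inE !eqxx ?orbT /= => /esym hb /esym ha.
have nab : a != b by apply: contraTneq ab => ->; rewrite sedge_irr.
move=> /esym /orP[/eqP ya|/eqP yb] /esym /orP[/eqP xa|/eqP xb]; subst => //.
- by move: hb; rewrite eq_sym (negPf nab).
- by rewrite sedge_sym.
- by move: ha; rewrite (negPf nab).
Qed.

Lemma spanning_tree (G : sgraph) :
  connected G -> exists F, subtree [set: G] F.
Proof.
move=> [G0 connG].
pose ok (F : {set {set G}}) := (F \subset edges G) &&
  [forall x, forall y, connect (adj_of F) x y].
have okE : ok (edges G).
  rewrite /ok subxx; apply/forallP => x; apply/forallP => y.
  by rewrite (eq_connect (@adj_of_edges G)); apply: connG; rewrite inE.
case: (minset_exists okE) => F /minsetP[/andP[FE /forallP Fc] Fmin] _.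
exists F; split=> //; first by split=> // x y _ _; apply: (forallP (Fc x)).
case=> [|x [|y [|z p]]] //= _ /andP[/= /andP[xy yp] /andP[xnp /andP[ynp _]]].
set q := z :: p in yp xnp ynp.
pose F' := F :\ [set x; y].
have xnq : x \notin y :: q by [].
have ynq : y \notin q by [].
have yx' : connect (adj_of F') y x.
  apply/connectP; exists (rcons q x); last by rewrite last_rcons.
  have {}yp : path (adj_of F) y (rcons q x) by [].
  move: yp; rewrite !rcons_path => /andP[yq lx]; apply/andP; split.
    apply: (@sub_in_path _ (predC1 x) (adj_of F)) yq => [a b ax bx ab|].
      rewrite /adj_of !inE; apply/andP; split=> //.
      apply/eqP => /setP /(_ x); rewrite !inE eqxx /=.
      by rewrite !(eq_sym x) (negPf ax) (negPf bx).
    by apply/allP => a aq; apply: contraNneq xnq => <-.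
  rewrite /adj_of !inE; apply/andP; split=> //.
  have lq : last y q \in q by rewrite /= mem_last.
  apply/eqP => /setP /(_ y); rewrite !inE eqxx orbT.
  rewrite (_ : y == last y q = false); last by apply: contraNF ynq => /eqP->.
  by move/eqP=> yx; case/negP: xnq; rewrite -yx mem_head.
have sym' : connect_sym (adj_of F') by apply/sym_connect_sym/adj_of_sym.
have okF' : ok F'.
  apply/andP; split; first by apply: subset_trans FE; apply: subsetDl.
  apply/forallP => a; apply/forallP => b.
  apply: connect_sub (forallP (Fc a) b) => u v uv.
  have [euv|nuv] := eqVneq [set u; v] [set x; y]; last first.
    by apply: connect1; rewrite /adj_of !inE nuv.
  have := set21 u v; have := set22 u v; rewrite euv !inE.
  case/orP=> /eqP -> /orP[] /eqP -> //; by rewrite ?connect0 // sym'.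
have := Fmin _ okF' (subsetDl _ _) => /setP /(_ [set x; y]).
by rewrite !inE eqxx /=; move: xy; rewrite /adj_of => ->.
Qed.

Lemma rainbow3_colorable_ex (G : sgraph) :
  connected G -> exists k, `[< rainbow3_colorable G k >].
Proof.
move=> /spanning_tree[F treeF]; exists #|{set G}|; apply/asboolP.
exists enum_rank => S _; exists [set: G], F; split; last exact: subsetT.
by split=> // a b _ _; apply: enum_rank_inj.
Qed.

Definition rx3 (G : sgraph) (connG : connected G) : nat :=
  ex_minn (rainbow3_colorable_ex connG).

(* Main.v *)
(* Growing a clique Q to {u} + N(u) /\ Q shows that a connected
   (P5,C5)-free graph has a dominating clique K, and the same holds in every
   component of G - K. In such a component C with at least two vertices, let Q
   be a minimal dominating clique among those with at least two vertices, h a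
   vertex of Q (its hub) and W = C - Q. Seven colors outside K give every vertex
   three routes to K:
   - edges to K get colors 1, 2, 3: mostly 1 on Q - h, 3 on h, and 2 or 3 on W,
     where each vertex of W with a neighbour in W has one of the other color;
   - edges inside Q get 6, edges inside W get 7, edges between W and Q get 4,
     except that a vertex of W with no neighbour in W and only one in K has two
     neighbours in Q and sends color 5 to one of them.
   The color sets of the routes depend on one of five kinds of the vertex, any
   three kinds admit pairwise disjoint choices, and four more colors join any
   three vertices of K. So rx3 <= 11, while a spanning tree gives rx3 <= n - 1;
   the bound follows from min(11, n - 1) <= 11n/16 + 3. *)
Require Import Defs.
From mathcomp Require Import all_boot all_order all_algebra.
From mathcomp Require Import boolp zify lra.
Import Order.TTheory GRing.Theory Num.Theory.

Set Implicit Arguments.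
Unset Strict Implicit.
Unset Printing Implicit Defensive.

(** * Connectivity by edge sets and extraction of trees *)

Lemma connect_exit (T : finType) (r : rel T) (A : {set T}) (x y : T) :
  connect r x y -> x \in A -> y \notin A ->
  exists u v, [/\ u \in A, v \notin A & r u v].
Proof.
case/connectP=> p; elim: p x => [|z p IHp] x /= => [_ -> -> //|].
case/andP=> xz zp yE xA yA; have [zA|zA] := boolP (z \in A).
  exact: IHp zp yE zA yA.
by exists x, z.
Qed.

Lemma set2_inj (T : finType) (x y a b : T) :
  [set x; y] = [set a; b] -> x = a /\ y = b \/ x = b /\ y = a.
Proof.
move/setP=> E; have := E x; have := E y; have := E a; have := E b.
rewrite !inE !eqxx ?orbT /= => hb ha /esym/orP[]/eqP hy /esym/orP[]/eqP hx.
- by subst; move: hb; rewrite orbb => /eqP; left.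
- by right.
- by left.
- by subst; move: ha; rewrite orbb => /eqP; left.
Qed.

Lemma set2_edge (G : sgraph) (x y : G) :
  ([set x; y] \in edges G) = sedge x y.
Proof. exact: adj_of_edges. Qed.

Lemma connect_adj_sub (T : finType) (F F' : {set {set T}}) (x y : T) :
  F \subset F' -> connect (adj_of F) x y -> connect (adj_of F') x y.
Proof.
by move=> FF'; apply: connect_sub => a b ab; apply/connect1/(subsetP FF').
Qed.

Lemma connect_adj_sym (T : finType) (F : {set {set T}}) :
  connect_sym (adj_of F).
Proof. exact/sym_connect_sym/adj_of_sym. Qed.

Lemma subtree_set1 (G : sgraph) (x : G) : subtree [set x] set0.
Proof.
split; rewrite ?sub0set /cover ?big_set0 ?sub0set //.
  split; first by apply/set0Pn; exists x; rewrite inE.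
  by move=> a b /set1P-> /set1P->.
by case=> [|a [|b c]] // _; rewrite /ucycle /= /adj_of inE.
Qed.

(** The new vertex [b] has [a] as its only neighbour, so it lies on no cycle. *)
Lemma subtree_add_leaf (G : sgraph) (V : {set G}) (F : {set {set G}})
    (a b : G) :
  subtree V F -> a \in V -> b \notin V -> sedge a b ->
  subtree (b |: V) ([set a; b] |: F).
Proof.
case=> FE FV [_ Fc] Fac aV bV ab; set F' := [set a; b] |: F.
have FF' : F \subset F' by exact: subsetUr.
have FnV x y : [set x; y] \in F -> x \in V.
  by move=> xyF; apply/(subsetP FV)/bigcupP; exists [set x; y]; rewrite ?set21.
have F'b x : adj_of F' b x -> x = a.
  rewrite /adj_of !inE => /orP[/eqP/set2_inj[[ba]|[]//]|/FnV bV'].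
    by rewrite ba aV in bV.
  by rewrite bV' in bV.
have F'nb x y : x != b -> y != b -> adj_of F' x y -> adj_of F x y.
  move=> xb yb; rewrite /adj_of !inE => /orP[/eqP/set2_inj[[_ yb']|[xb']]|//].
    by rewrite yb' eqxx in yb.
  by rewrite xb' eqxx in xb.
split.
- by rewrite subUset FE sub1set set2_edge ab.
- apply/bigcupsP => e; rewrite !inE => /orP[/eqP->|eF].
    by rewrite subUset !sub1set !inE eqxx aV orbT.
  by apply: subset_trans (subsetUr _ _); apply: subset_trans FV; apply: bigcup_sup.
- split; first by apply/set0Pn; exists b; rewrite !inE eqxx.
  have ca x : x \in b |: V -> connect (adj_of F') a x.
    rewrite !inE => /orP[/eqP->|xV]; first by apply: connect1; rewrite /adj_of setU11.

    by apply: connect_adj_sub FF' _; apply: Fc.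
  by move=> x y xV yV; apply: connect_trans (ca y yV); rewrite connect_adj_sym ca.
move=> c c2; have [bc /andP[cc cu]|bc /andP[cc cu]] := boolP (b \in c).
  (* Rotated to start at [b], the cycle has [a] both as its second and as its last vertex, which
     contradicts [uniq]. *)
  case: (rot_to bc) => i c' Ec; move: c2 cc cu.
  rewrite -(size_rot i c) -(rot_cycle i) -(rot_uniq i c) Ec {Ec}.
  case: c' => [|x p] //; case/lastP: p => [|p y] // _ /=.
  rewrite rcons_path last_rcons => /and3P[/F'b-> _].
  rewrite adj_of_sym => /F'b-> /and3P[_].
  by rewrite mem_rcons mem_head.
apply: (Fac c c2); rewrite /ucycle cu andbT.
apply: (@sub_in_cycle _ (predC1 b) (adj_of F')) cc => [x y xb yb|]; first exact: F'nb.
by apply/allP => x xc; apply: contraNneq bc => <-.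
Qed.

(** A subtree inside [F] through [x] with maximal vertex set works: an edge of [F] leaving it would
    add a leaf. The bound on [#|F'|] later limits the number of colors of a spanning tree. *)
Lemma subtree_reach (G : sgraph) (F : {set {set G}}) (x : G) :
  F \subset edges G ->
  exists V F', [/\ subtree V F', F' \subset F, #|F'| < #|V| &
    forall y, connect (adj_of F) x y -> y \in V].
Proof.
move=> FE.
pose P (V : {set G}) := `[< exists F' : {set {set G}},
  [/\ subtree V F', F' \subset F, #|F'| < #|V| & x \in V] >].
have P1 : P [set x].
  apply/asboolP; exists set0; split; rewrite ?sub0set ?cards0 ?cards1 ?set11 //.
  exact: subtree_set1.
case: (maxset_exists P1) => V /maxsetP[/asboolP[F' [tF' F'F ltF' xV]] Vmax] _.
exists V, F'; split=> // y xy; apply: contraPT isT => yV.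
case: (connect_exit xy xV yV) => a [b [aV bV abF]].
have ab : sedge a b by rewrite -set2_edge; apply: (subsetP FE).
have/setP/(_ b) : b |: V = V.
  apply: Vmax (subsetUr _ _); apply/asboolP; exists ([set a; b] |: F').
  split; first exact: subtree_add_leaf.
  - by rewrite subUset F'F andbT sub1set.
  - rewrite [X in _ < X]cardsU1 bV cardsU1 /= add1n.
    by case: (_ \notin _) => //; apply: leqW.
  - by rewrite !inE xV orbT.
by rewrite !inE eqxx (negPf bV).
Qed.

(** Reduces the search for a rainbow tree to that of a rainbow edge set connecting [S]; cycles in
    [F] are removed by passing to a subtree. *)
Lemma rainbow_tree_of_connected (G : sgraph) (k : nat) (c : {set G} -> 'I_k)
    (F : {set {set G}}) (x : G) (S : {set G}) :
  F \subset edges G -> {in F &, injective c} ->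
  {in S, forall y, connect (adj_of F) x y} ->
  exists V F', rainbow_tree c V F' /\ S \subset V.
Proof.
move=> FE cF xS; case: (subtree_reach x FE) => V [F' [tF' F'F _ VF]].
exists V, F'; split; last by apply/subsetP => y /xS/VF.
by split=> //; apply: sub_in2 cF => e /(subsetP F'F).
Qed.

(** * Dominating cliques in graphs without induced [P5] and [C5] *)

Lemma induced_subgraph_of_mono (H G : sgraph) (f : H -> G) :
  (forall x y : H, sedge x =1 sedge y -> x = y) ->
  {mono f : x y / sedge x y} -> induced_subgraph H G.
Proof.
move=> Hsep fm; exists f; split=> // x y fxy; apply: Hsep => z.
by rewrite -!fm fxy.
Qed.

(** The hypotheses fix every adjacency except that of [v0] and [v4], which decides between the path
    and the cycle. *)
Lemma induced_P5_or_C5 (G : sgraph) (v0 v1 v2 v3 v4 : G) :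
  sedge v0 v1 -> sedge v1 v2 -> sedge v2 v3 -> sedge v3 v4 ->
  ~~ sedge v0 v2 -> ~~ sedge v0 v3 -> ~~ sedge v1 v3 ->
  ~~ sedge v1 v4 -> ~~ sedge v2 v4 ->
  induced_subgraph P5 G \/ induced_subgraph C5 G.
Proof.
move=> e01 e12 e23 e34 /negPf n02 /negPf n03 /negPf n13 /negPf n14 /negPf n24.
pose f (i : 'I_5) := nth v0 [:: v0; v1; v2; v3; v4] i.
have fE := (e01, e12, e23, e34, n02, n03, n13, n14, n24).
have sfE := (sedge_irr, fE, sedge_sym v1 v0, sedge_sym v2 v1, sedge_sym v3 v2,
  sedge_sym v4 v3, sedge_sym v2 v0, sedge_sym v3 v0, sedge_sym v3 v1,
  sedge_sym v4 v1, sedge_sym v4 v2, sedge_sym v4 v0).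
have [e04|/negPf n04] := boolP (sedge v0 v4); [right|left].
  apply: (@induced_subgraph_of_mono C5 G f).
    move=> [[|[|[|[|[|x]]]]] Hx] // [[|[|[|[|[|y]]]]] Hy] // E; try exact: val_inj;
    by move: (E (@Ordinal 5 0 isT)) (E (@Ordinal 5 1 isT)) (E (@Ordinal 5 2 isT))
      (E (@Ordinal 5 3 isT)) (E (@Ordinal 5 4 isT)).
  by move=> [[|[|[|[|[|x]]]]] Hx] // [[|[|[|[|[|y]]]]] Hy] //; rewrite /f /= ?sfE ?e04.
apply: (@induced_subgraph_of_mono P5 G f).
  move=> [[|[|[|[|[|x]]]]] Hx] // [[|[|[|[|[|y]]]]] Hy] // E; try exact: val_inj;
  by move: (E (@Ordinal 5 0 isT)) (E (@Ordinal 5 1 isT)) (E (@Ordinal 5 2 isT))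
    (E (@Ordinal 5 3 isT)) (E (@Ordinal 5 4 isT)).
by move=> [[|[|[|[|[|x]]]]] Hx] // [[|[|[|[|[|y]]]]] Hy] //; rewrite /f /= ?sfE ?n04.
Qed.

Definition clique (G : sgraph) (Q : {set G}) : bool :=
  [forall x in Q, forall y in Q, (x != y) ==> sedge x y].

Definition dominated (G : sgraph) (Q : {set G}) : {set G} :=
  [set x | (x \in Q) || [exists q in Q, sedge q x]].

Lemma cliqueP (G : sgraph) (Q : {set G}) :
  reflect {in Q &, forall x y, x != y -> sedge x y} (clique Q).
Proof.
apply: (iffP forall_inP) => [QP x y xQ yQ|QP x xQ].
  by have /forall_inP/(_ y yQ)/implyP := QP x xQ.
by apply/forall_inP => y yQ; apply/implyP; apply: QP.
Qed.

(* For a clique Q and an undominated vertex v with a dominated neighbour u, the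
   clique {u} + N(u) /\ Q dominates v and everything that Q dominates: a
   lost vertex w, attached to k in Q, gives the P5 or C5 v - u - a - k - w. *)
Lemma dominating_clique (G : sgraph) (C : {set G}) :
  ~ induced_subgraph P5 G -> ~ induced_subgraph C5 G -> C != set0 ->
  (forall A : {set G}, A \subset C -> A != set0 -> A != C ->
     exists x y, [/\ x \in A, y \in C :\: A & sedge x y]) ->
  exists Q : {set G}, [/\ clique Q, Q != set0, Q \subset C & C \subset dominated Q].
Proof.
move=> noP5 noC5 /set0Pn[x0 x0C] Ccon.
pose P (Q : {set G}) := [&& clique Q, Q != set0 & Q \subset C].
have P1 : P [set x0].
  rewrite /P sub1set x0C andbT; apply/andP; split.
    by apply/cliqueP => x y /set1P-> /set1P->; rewrite eqxx.
  by apply/set0Pn; exists x0; rewrite inE.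
(* [Q] dominates as many vertices of [C] as possible, so an undominated vertex is refuted by a
   clique that dominates more. *)
case: (arg_maxnP (fun Q : {set G} => #|dominated Q :&: C|) P1).
move=> Q /and3P[cQ Q0 QC] Qmax; exists Q; split=> //.
have [/eqP DC|DC] := boolP (dominated Q :&: C == C).
  by rewrite -DC subsetIl.
have QD : Q \subset dominated Q by apply/subsetP => x xQ; rewrite inE xQ.
case: (Ccon (dominated Q :&: C) (subsetIr _ _) _ DC).
  case/set0Pn: Q0 => x xQ; apply/set0Pn; exists x.
  by rewrite inE (subsetP QD) ?(subsetP QC).
move=> u [v [/setIP[uD uC] /setDP[vC + uv]]]; rewrite inE vC andbT => vD.
have vQ k : k \in Q -> sedge k v = false.
  move=> kQ; apply: contraNF vD => kv; rewrite inE; apply/orP; right.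
  by apply/exists_inP; exists k.
have uQ : u \notin Q by apply: contraTN uv => uQ; rewrite vQ.
move: (uD); rewrite inE (negPf uQ) => /exists_inP[a aQ au].
pose Q' := u |: [set k in Q | sedge k u].
have PQ' : P Q'.
  apply/and3P; split.
  - apply/cliqueP => x y; rewrite !inE.
    case/orP=> [/eqP->|/andP[xQ xu]] /orP[/eqP->|/andP[yQ yu]] //.
    + by rewrite eqxx.
    + by rewrite sedge_sym yu.
    + exact: (cliqueP _ cQ).
  - by apply/set0Pn; exists u; rewrite !inE eqxx.
  - by rewrite subUset sub1set uC; apply/subsetP => x; rewrite inE => /andP[/(subsetP QC)].
have uQ' : u \in Q' by rewrite !inE eqxx.
have aQ' : a \in Q' by rewrite !inE aQ au orbT.
have DD' : dominated Q \subset dominated Q'.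
  apply/subsetP => w wD; apply: contraT => wD'.
  have nQ' k : k \in Q' -> ~~ sedge k w.
    move=> kQ'; apply: contraNN wD' => kw; rewrite inE; apply/orP; right.
    by apply/exists_inP; exists k.
  have wQ : w \notin Q.
    apply/negP => wQ; have [aw|aw] := eqVneq a w.
      by case/negP: wD'; rewrite -aw inE aQ'.
    by have := nQ' a aQ'; rewrite (cliqueP _ cQ).
  move: wD; rewrite inE (negPf wQ) => /exists_inP[k kQ kw].
  have ku : ~~ sedge k u.
    by apply/negP => ku; have := nQ' k; rewrite kw !inE kQ ku orbT => /(_ isT).
  have ak : sedge a k.
    by apply: (cliqueP _ cQ) => //; apply: contraNneq ku => <-.
  have [] // := @induced_P5_or_C5 G v u a k w _ _ ak kw _ _ _ (nQ' u uQ') (nQ' a aQ').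
  - by rewrite sedge_sym.
  - by rewrite sedge_sym.
  - by rewrite sedge_sym vQ.
  - by rewrite sedge_sym vQ.
  - by rewrite sedge_sym.
have /= := Qmax _ PQ'; rewrite leqNgt => /negP[]; apply: proper_card.
apply/properP; split; first exact: setSI.
exists v.
  by rewrite !inE vC andbT; apply/orP; right; apply/exists_inP; exists u.
by rewrite inE vC andbT.
Qed.

Definition neighbors (G : sgraph) (x : G) : {set G} := [set y | sedge x y].

(* A vertex q outside both neighbours would leave Q : \ q dominating, so
   minimality of Q provides the last property. *)
Lemma component_clique (G : sgraph) (K C : {set G}) :
  ~ induced_subgraph P5 G -> ~ induced_subgraph C5 G ->
  (forall x : G, 3 <= #|neighbors x|) ->
  {in C, forall x, neighbors x \subset K :|: C} -> 1 < #|C| ->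
  (forall A : {set G}, A \subset C -> A != set0 -> A != C ->
     exists x y, [/\ x \in A, y \in C :\: A & sedge x y]) ->
  exists Q : {set G}, [/\ clique Q, Q \subset C, 1 < #|Q|, C \subset dominated Q &
    {in Q, forall q, (exists2 w, w \in C :\: Q & sedge q w) \/
       1 < #|neighbors q :&: K|}].
Proof.
move=> noP5 noC5 deg Cnb C1 Ccon.
have C0 : C != set0 by rewrite -card_gt0 (ltn_trans _ C1).
pose P (Q : {set G}) := [&& clique Q, Q \subset C, 1 < #|Q| & C \subset dominated Q].
(* If the dominating clique is a single vertex [q], any other vertex of [C] is adjacent to [q] and
   can be added. *)
have [Q1 PQ1] : exists Q, P Q.
  have [Q [cQ Q0 QC CD]] := dominating_clique noP5 noC5 C0 Ccon.
  have [lt1Q|] := boolP (1 < #|Q|); first by exists Q; apply/and4P.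
  rewrite -leqNgt leq_eqVlt ltnS leqn0 cards_eq0 (negPf Q0) orbF => /cards1P[q Eq].
  have qC : q \in C by rewrite (subsetP QC) // Eq set11.
  have [c cC cq] : exists2 c, c \in C & c != q.
    apply/exists_inP; apply: contraLR C1; rewrite negb_exists_in => /forall_inP Cq.
    rewrite -leqNgt -(cards1 q) subset_leq_card //; apply/subsetP => c /Cq.
    by rewrite negbK inE.
  have qc : sedge q c.
    have /= := subsetP CD c cC; rewrite Eq !inE (negPf cq) /=.
    by case/exists_inP=> x /set1P->.
  exists [set q; c]; apply/and4P; split.
  - apply/cliqueP => x y; rewrite !inE => /orP[]/eqP-> /orP[]/eqP->; rewrite ?eqxx //.
    by rewrite sedge_sym.
  - by rewrite subUset !sub1set qC.
  - by rewrite cards2 eq_sym cq.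
  - apply: subset_trans CD _; rewrite Eq; apply/subsetP => x; rewrite !inE.
    case/orP=> [->//|/exists_inP[y /set1P-> qx]]; apply/orP; right.
    by apply/exists_inP; exists q; rewrite ?set21.
case: (minset_exists PQ1) => Q /minsetP[/and4P[cQ QC lt1Q CD] Qmin] _.
exists Q; split=> // q qQ.
have [/exists_inP ?|/exists_inPn nW] := boolP [exists w in C :\: Q, sedge q w]; first by left.
have [|le1] := boolP (1 < _); [by right | exfalso; rewrite -leqNgt in le1].
have nqQ : neighbors q \subset (neighbors q :&: K) :|: (Q :\ q).
  apply/subsetP => x qx; have := subsetP (Cnb q (subsetP QC q qQ)) x qx.
  rewrite inE => /orP[xK|xC]; first by rewrite in_setU in_setI qx xK.
  have xQ : x \in Q.
    by apply: contraTT qx => xQ; rewrite inE nW // inE xQ.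
  rewrite !inE xQ andbT; apply/orP; right; apply: contraTneq qx => ->.
  by rewrite inE sedge_irr.
(* Of at least three neighbours of [q], at most one lies in [K]; the others lie in [Q :\ q]. *)
have lt1Q' : 1 < #|Q :\ q|.
  have := leq_trans (deg q) (leq_trans (subset_leq_card nqQ) (leq_card_setU _ _)).
  by move/leq_trans/(_ (leq_add le1 (leqnn _))).
have /setP/(_ q) : Q :\ q = Q.
  apply: Qmin (subsetDl _ _); apply/and4P; split=> //.
  - by apply/cliqueP => x y /setD1P[_ xQ] /setD1P[_ yQ]; apply: (cliqueP _ cQ).
  - by apply: subset_trans QC; apply: subsetDl.
  - apply/subsetP => x xC; have := subsetP CD x xC; rewrite !inE.
    have [xQ _|xQ /=] := boolP (x \in Q).
      have [->|//] := eqVneq x q; rewrite /=.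
      have /set0Pn[p pQ] : Q :\ q != set0 by rewrite -card_gt0 (ltn_trans _ lt1Q').
      apply/exists_inP; exists p => //; case/setD1P: pQ => pq pQ.
      exact: (cliqueP _ cQ).
    case/exists_inP=> p pQ px; apply/orP; right; apply/exists_inP; exists p => //.
    rewrite !inE pQ andbT; apply: contraTneq px => ->.
    by apply: nW; rewrite inE xQ.
by rewrite !inE eqxx qQ.
Qed.

(** * Cliques and hubs in the components outside [K] *)

(** Treats all components of G - K with at least two vertices at once: [U] is the union of their
    vertex sets, [Q] the union of their chosen cliques, and [H] has one hub from each. The
    conditions are local, so the coloring can ignore the components; [hub_uniq] is what remains of a
    component having a single hub. *)
Record hub_structure (G : sgraph) (K U Q H : {set G}) : Prop := HubStructure {
  hub_sub : H \subset Q;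
  hubs_sub : Q \subset U;
  hub_dom : {in U :\: Q, forall w, exists2 q, q \in Q & sedge w q};
  hub_adj : {in Q :\: H, forall q, exists2 h, h \in H & sedge q h};
  hub_spoke : {in H, forall h, exists2 q, q \in Q :\: H & sedge h q};
  hub_uniq : forall w h1 h2, w \in U -> h1 \in H -> h2 \in H ->
    sedge w h1 -> sedge w h2 -> h1 = h2;
  hub_exit : {in Q, forall q, (exists2 w, w \in U :\: Q & sedge q w) \/
    1 < #|neighbors q :&: K|} }.

Lemma hub_structure_exists (G : sgraph) (K : {set G}) :
  ~ induced_subgraph P5 G -> ~ induced_subgraph C5 G ->
  (forall x : G, 3 <= #|neighbors x|) ->
  exists Q H, hub_structure K
    [set x | (x \notin K) && [exists y, (y \notin K) && sedge x y]] Q H.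
Proof.
move=> noP5 noC5 deg; set U := [set x | _].
(* The classes of [r] are the components of G - K, together with singletons for the vertices of [K];
   [U] consists of the vertices whose class is not a singleton. *)
pose r := [rel x y : G | [&& x \notin K, y \notin K & sedge x y]].
have rsym : connect_sym r.
  by apply: sym_connect_sym => x y /=; rewrite sedge_sym andbCA.
pose C v := [set u | connect r v u].
have CE u v : u \in C v -> C u = C v.
  rewrite inE => vu; apply/setP => w; rewrite !inE.
  by rewrite (same_connect rsym vu).
have Cid v : v \in C v by rewrite inE connect0.
have UP v : reflect (exists w, r v w) (v \in U).
  rewrite inE; apply: (iffP andP) => [[vK /existsP[w /andP[wK vw]]]|[w /and3P[vK wK vw]]].
    by exists w; rewrite /= vK wK.
  by split=> //; apply/existsP; exists w; rewrite wK.
have CU u v : u \in C v -> v \in U -> u \in U.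
  rewrite inE => vu vU; have [->//|uv] := eqVneq u v.
  rewrite rsym in vu; have := connect_exit vu (set11 u).
  by rewrite inE eq_sym uv => /(_ isT)[_ [w [/set1P-> _ uw]]]; apply/UP; exists w.
have UK u : u \in U -> u \notin K by rewrite inE => /andP[].
have UC u w : u \in U -> sedge u w -> w \notin K -> w \in C u.
  by move=> /UK uK uw wK; rewrite inE connect1 //= uK wK.
have Cgood v : v \in U -> exists Q : {set G}, [/\ clique Q, Q \subset C v, 1 < #|Q|,
    C v \subset dominated Q &
    {in Q, forall q, (exists2 w, w \in C v :\: Q & sedge q w) \/
       1 < #|neighbors q :&: K|}].
  move=> vU; apply: component_clique => //.
  - move=> x xC; apply/subsetP => y; rewrite !inE => xy.
    have [//|yK /=] := boolP (y \in K); move: (UC x y (CU x v xC vU) xy yK).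
    by rewrite (CE _ _ xC) inE.
  - case/UP: (vU) => w vw; have vnw : v != w.
      by apply: contraTneq vw => <-; rewrite /= sedge_irr !andbF.
    have : [set v; w] \subset C v by rewrite subUset !sub1set Cid inE connect1.
    by move/subset_leq_card; rewrite cards2 vnw.
  - move=> A AC /set0Pn[x xA] nAC.
    have [y yC yA] : exists2 y, y \in C v & y \notin A.
      by apply/subsetPn; apply: contraNN nAC => CA; rewrite eqEsubset AC.
    have xy : connect r x y.
      have := yC; rewrite -(CE x v (subsetP AC x xA)) inE //.
    case: (connect_exit xy xA yA) => a [b [aA bA /and3P[aK bK ab]]].
    exists a, b; split=> //; rewrite inE bA; have aC := subsetP AC a aA.
    by rewrite -(CE _ _ aC) UC // (CU _ _ aC vU).
have /choice[f fP] : forall x, exists p : {set G} * G, x \in U ->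
    [/\ clique p.1, p.1 \subset C x, C x \subset dominated p.1, p.2 \in p.1 &
     (exists2 q, q \in p.1 & q != p.2) /\
     {in p.1, forall q, (exists2 w, w \in C x :\: p.1 & sedge q w) \/
       1 < #|neighbors q :&: K|}].
  move=> x; have [xU|_] := boolP (x \in U); last by exists (set0, x).
  have [Q [cQ QC /card_gt1P[h [q [hQ qQ hq]]] CD Qex]] := Cgood x xU.
  exists (Q, h) => _; split=> //=; split=> //.
  by exists q => //; rewrite eq_sym.
(* Reading the choice at the canonical root makes clique and hub constant on each component. *)
pose g v := f (fingraph.root r v).
have rootC v : fingraph.root r v \in C v by rewrite inE connect_root.
have gC u v : u \in C v -> g u = g v.
  by rewrite inE => vu; rewrite /g; congr f; apply/esym/(fingraph.rootP rsym).
have gP v : v \in U -> [/\ clique (g v).1, (g v).1 \subset C v,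
    C v \subset dominated (g v).1, (g v).2 \in (g v).1 &
    (exists2 q, q \in (g v).1 & q != (g v).2) /\
    {in (g v).1, forall q, (exists2 w, w \in C v :\: (g v).1 & sedge q w) \/
       1 < #|neighbors q :&: K|}].
  move=> vU; have := fP (fingraph.root r v) (CU _ _ (rootC v) vU).
  by rewrite (CE _ _ (rootC v)).
pose Q := [set v in U | v \in (g v).1]; pose H := [set v in U | v == (g v).2].
have QgP v q : v \in U -> q \in C v -> (q \in Q) = (q \in (g v).1).
  by move=> vU qC; rewrite inE (gC q v qC) (CU _ _ qC vU).
have HgP v h : v \in U -> h \in C v -> (h \in H) = (h == (g v).2).
  by move=> vU hC; rewrite inE (gC h v hC) (CU _ _ hC vU).
have QU : Q \subset U by apply/subsetP => q; rewrite inE => /andP[].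
have HQ : H \subset Q.
  apply/subsetP => h; rewrite inE => /andP[hU /eqP hE].
  by rewrite inE hU {1}hE; case: (gP h hU).
exists Q, H; split=> //.
- move=> w /setDP[wU wQ]; have [_ gw /subsetP/(_ w (Cid w)) wD _ _] := gP w wU.
  move: wD; rewrite inE -(QgP w) // (negPf wQ) => /exists_inP[q qg qw].
  by exists q; rewrite 1?sedge_sym // (QgP w) // (subsetP gw).
- move=> q /setDP[qQ qH]; have qU := subsetP QU q qQ.
  have [cg gq _ hg _] := gP q qU; have hC := subsetP gq _ hg.
  exists (g q).2; first by rewrite (HgP q).
  apply: (cliqueP _ cg) => //; first by rewrite -(QgP q).
  by rewrite -(HgP q).
- move=> h hH; have hU := subsetP QU h (subsetP HQ h hH).
  have [cg gh _ _ [[q qg qh] _]] := gP h hU; have qC := subsetP gh q qg.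
  move: qh; rewrite -(HgP h) // => qH.
  exists q; first by rewrite inE qH (QgP h).
  apply: (cliqueP _ cg) => //; first by rewrite -(QgP h) // (subsetP HQ).
  by apply: contraNneq qH => <-.
- move=> w h1 h2 wU h1H h2H wh1 wh2.
  have inC h : h \in H -> sedge w h -> h \in C w.
    by move=> hH wh; apply: UC => //; apply/UK/(subsetP QU)/(subsetP HQ).
  have h1C := inC h1 h1H wh1; have h2C := inC h2 h2H wh2.
  by move: h1H h2H; rewrite !(HgP w) // => /eqP-> /eqP->.
- move=> q qQ; have qU := subsetP QU q qQ.
  have [_ _ _ _ [_ /(_ q)]] := gP q qU; rewrite -(QgP q) // => /(_ qQ)[[w /setDP[wC wg] qw]|]; last by right.
  by left; exists w => //; rewrite inE (QgP q) // wg (CU _ _ wC).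
Qed.

(** [M] is a maximal independent subset of [W]: neighbours in [W] of a vertex of [M] are outside
    [M], and by maximality a vertex of [W] outside [M] has a neighbour in [M]. *)
Lemma opposite_sides (G : sgraph) (W : {set G}) :
  exists M : {set G}, forall w x, w \in W -> x \in W -> sedge w x ->
    exists y, [/\ y \in W, sedge w y & (y \in M) = (w \notin M)].
Proof.
pose P (M : {set G}) := (M \subset W) &&
  [forall x in M, forall y in M, ~~ sedge x y].
have P0 : P set0.
  by rewrite /P sub0set; apply/forall_inP => x; rewrite inE.
case: (maxset_exists P0) => M /maxsetP[/andP[MW /forall_inP Mind] Mmax] _.
exists M => w x wW xW wx; have [wM|wM] := boolP (w \in M).
  exists x; split=> //; apply: contraTF wx => xM.
  by have /forall_inP := Mind w wM; apply.
have [/exists_inP[y yM wy]|/exists_inPn nM] := boolP [exists y in M, sedge w y].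
  by exists y; rewrite yM (subsetP MW).
have : w |: M = M; last by move=> E; rewrite -E setU11 in wM.
apply: Mmax (subsetUr _ _); rewrite /P subUset sub1set wW MW /=.
apply/forall_inP => a aM; apply/forall_inP => b bM.
case/setU1P: aM bM => [->|aM] /setU1P[->|bM].
- by rewrite sedge_irr.
- exact: nM.
- by rewrite sedge_sym nM.
- by have /forall_inP := Mind a aM; apply.
Qed.

(** * Colorings from pairs, rainbow routes and their union *)

(** The pair is an arbitrary choice of endpoints, harmless when [cc] is symmetric; sets that are not
    of the form [[set x; y]] get color 0. *)
Definition edge_color (G : sgraph) (k : nat) (cc : G -> G -> nat) (e : {set G}) :
    'I_k.+1 :=
  inord (if [pick p : G * G | e == [set p.1; p.2]] is Some p
         then cc p.1 p.2 else 0).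

Lemma edge_colorE (G : sgraph) (k : nat) (cc : G -> G -> nat) (x y : G) :
  (forall a b, cc a b = cc b a) -> cc x y <= k ->
  edge_color k cc [set x; y] = cc x y :> nat.
Proof.
move=> ccC cxy; rewrite /edge_color; case: pickP => [[a b] /= /eqP E|/(_ (x, y))].
  have -> : cc a b = cc x y by case: (set2_inj E) => -[-> ->].
  by rewrite inordK.
by rewrite eqxx.
Qed.

Section Rainbow.
Context (G : sgraph) (k : nat) (c : {set G} -> 'I_k).

(** [D] lists the permitted colors rather than the used ones, so that disjointness of lists is
    enough to unite rainbow edge sets. *)
Definition rainbow_in (D : seq nat) (F : {set {set G}}) : Prop :=
  [/\ F \subset edges G, {in F &, injective c} &
      {in F, forall e, (c e : nat) \in D}].

Definition disjoint_seq (D E : seq nat) : bool := ~~ has (mem D) E.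

Lemma rainbow_in0 (D : seq nat) : rainbow_in D set0.
Proof. by split; [apply: sub0set | move=> e e'; rewrite inE | move=> e; rewrite inE]. Qed.

Lemma rainbow_in_sub (D E : seq nat) (F : {set {set G}}) :
  {subset D <= E} -> rainbow_in D F -> rainbow_in E F.
Proof. by move=> DE [FE Fc FD]; split=> // e /FD/DE. Qed.

Lemma rainbow_inU (D1 D2 : seq nat) (F1 F2 : {set {set G}}) :
  disjoint_seq D1 D2 -> rainbow_in D1 F1 -> rainbow_in D2 F2 ->
  rainbow_in (D1 ++ D2) (F1 :|: F2).
Proof.
move=> /hasPn dD [E1 i1 c1] [E2 i2 c2].
have ne e e' : e \in F1 -> e' \in F2 -> c e <> c e'.
  move=> /c1 h1 /c2 h2 E; have := dD _ h2.
  by rewrite -E /= h1.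
split.
- by rewrite subUset E1.
- move=> e e' /setUP[] h /setUP[] h' E.
  + exact: i1.
  + by case: (ne e e').
  + by case: (ne e' e).
  + exact: i2.
- by move=> e /setUP[/c1|/c2]; rewrite mem_cat => ->; rewrite ?orbT.
Qed.

Lemma rainbow_in1 (d : nat) (x y : G) :
  sedge x y -> c [set x; y] = d :> nat -> rainbow_in [:: d] [set [set x; y]].
Proof.
move=> xy cd; split; first by rewrite sub1set set2_edge.
  by move=> e e' /set1P-> /set1P->.
by move=> e /set1P->; rewrite cd inE.
Qed.

Definition route (K : {set G}) (v : G) (D : seq nat) : Prop :=
  exists F x, [/\ rainbow_in D F, x \in K & connect (adj_of F) v x].

Lemma route0 (K : {set G}) (v : G) (D : seq nat) : v \in K -> route K v D.
Proof. by exists set0, v; split=> //; apply: rainbow_in0. Qed.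

Lemma route_sub (K : {set G}) (v : G) (D E : seq nat) :
  {subset D <= E} -> route K v D -> route K v E.
Proof.
by move=> DE [F [x [FD xK vx]]]; exists F, x; split=> //; apply: rainbow_in_sub FD.
Qed.

Lemma route_cons (K : {set G}) (u v : G) (d : nat) (D : seq nat) :
  sedge u v -> c [set u; v] = d :> nat -> d \notin D -> route K v D ->
  route K u (d :: D).
Proof.
move=> uv cd dD [F [x [FD xK vx]]]; exists ([set [set u; v]] :|: F), x.
split=> //.
  apply: (rainbow_inU (D1 := [:: d])) => //; last exact: rainbow_in1.
  by rewrite /disjoint_seq has_sym /= orbF.
apply: connect_trans (connect_adj_sub (subsetUr _ _) vx).
by apply: connect1; rewrite /adj_of !inE eqxx.
Qed.

Definition linked (K : {set G}) (D : seq nat) : Prop :=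
  {in K & &, forall x y z, exists F,
    [/\ rainbow_in D F, connect (adj_of F) x y & connect (adj_of F) x z]}.

(** The routes lead to three vertices of [K], which are linked by colors of [D0]; disjoint color
    lists keep the union of the four edge sets rainbow. *)
Lemma rainbow_tree_of_routes (K : {set G}) (D0 D1 D2 D3 : seq nat)
    (v1 v2 v3 : G) :
  linked K D0 -> route K v1 D1 -> route K v2 D2 -> route K v3 D3 ->
  disjoint_seq D0 (D1 ++ D2 ++ D3) -> disjoint_seq D1 (D2 ++ D3) ->
  disjoint_seq D2 D3 ->
  exists V F, rainbow_tree c V F /\ [set v1; v2; v3] \subset V.
Proof.
move=> Klink [F1 [x1 [r1 x1K vx1]]] [F2 [x2 [r2 x2K vx2]]] [F3 [x3 [r3 x3K vx3]]].
move=> d0 d1 d2; have [F0 [r0 x12 x13]] := Klink _ _ _ x1K x2K x3K.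
have [FE Fi _] := rainbow_inU d0 r0 (rainbow_inU d1 r1 (rainbow_inU d2 r2 r3)).
apply: (rainbow_tree_of_connected (x := x1) FE Fi).
set F := F0 :|: _.
have sub0 : F0 \subset F by exact: subsetUl.
have sub1 : F1 \subset F by rewrite /F setUCA subsetUl.
have sub2 : F2 \subset F by rewrite /F !(setUCA _ F2) subsetUl.
have sub3 : F3 \subset F by rewrite /F !setUA subsetUr.
move=> v; rewrite !inE -orbA => /or3P[]/eqP->.
- by rewrite connect_adj_sym (connect_adj_sub sub1).
- apply: connect_trans (connect_adj_sub sub0 x12) _.
  by rewrite connect_adj_sym (connect_adj_sub sub2).
- apply: connect_trans (connect_adj_sub sub0 x13) _.
  by rewrite connect_adj_sym (connect_adj_sub sub3).
Qed.

End Rainbow.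

(* With hubs a1 and a2, the triple x, y, z of other vertices lies on the
   rainbow path x - y - a1 - a2 - z. *)
Lemma clique_coloring (G : sgraph) (K : {set G}) :
  clique K -> K != set0 ->
  exists kc : G -> G -> nat, [/\ forall x y, kc x y = kc y x,
    forall x y, kc x y <= 10 &
    forall k (c : {set G} -> 'I_k),
      {in K &, forall x y, x != y -> c [set x; y] = kc x y :> nat} ->
      linked c K [:: 0; 8; 9; 10]].
Proof.
move=> /cliqueP cK /set0Pn[a1 a1K].
have [K1|[a2 /setD1P[a21 a2K]]] := set_0Vmem (K :\ a1).
  have Ka x : x \in K -> x = a1.
    move=> xK; apply/eqP; apply: contraT => xa1.
    by have := in_set0 x; rewrite -K1 !inE xa1 xK.
  exists (fun _ _ => 0); split=> // k c _ x y z /Ka-> /Ka-> /Ka->.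
  by exists set0; split=> //; apply: rainbow_in0.
(* Color 0 joins the two hubs, 8 and 9 go to the other edges at [a1] and at [a2], and 10 to all
   remaining edges. *)
pose kc x y := if (x == a1) && (y == a2) || (x == a2) && (y == a1) then 0 else
  if (x == a1) || (y == a1) then 8 else if (x == a2) || (y == a2) then 9 else 10.
exists kc; split.
- by move=> x y; rewrite /kc orbC !(andbC (y == _)) !(orbC (x == _)).
- by move=> x y; rewrite /kc; do !case: ifP.
move=> k c cE.
have single x y d : x \in K -> y \in K -> x != y -> kc x y = d ->
    rainbow_in c [:: d] [set [set x; y]].
  by move=> xK yK xy <-; apply: rainbow_in1; rewrite ?cE ?cK.
have con (F : {set {set G}}) x y : [set x; y] \in F -> connect (adj_of F) x y by exact: connect1.
have r12 : rainbow_in c [:: 0] [set [set a1; a2]].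
  apply: single => //; first by rewrite eq_sym.
  by rewrite /kc !eqxx.
pose N := K :\: [set a1; a2].
have tripleN : {in N & &, forall x y z, exists F, rainbow_in c [:: 0; 8; 9; 10] F /\
    {in [set a1; a2; x; y; z], forall u, connect (adj_of F) a1 u}}.
  move=> x y z; rewrite !inE !negb_or => /andP[/andP[x1 x2] xK].
  move=> /andP[/andP[y1 y2] yK] /andP[/andP[z1 z2] zK].
  have r1y : rainbow_in c [:: 8] [set [set a1; y]].
    apply: single => //; first by rewrite eq_sym.
    by rewrite /kc eqxx (negPf y1) (negPf y2) (eq_sym a1) (negPf a21).
  have r2z : rainbow_in c [:: 9] [set [set a2; z]].
    apply: single => //; first by rewrite eq_sym.
    by rewrite /kc eqxx (negPf z1) (negPf z2) (negPf a21).
  pose Fxy := if x == y then set0 else [set [set x; y]].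
  have rxy : rainbow_in c [:: 10] Fxy.
    rewrite /Fxy; case: eqVneq => [_|xy]; first exact: rainbow_in0.
    by apply: single => //; rewrite /kc (negPf x1) (negPf x2) (negPf y1) (negPf y2).
  have r29 := rainbow_inU (isT : disjoint_seq [:: 9] [:: 10]) r2z rxy.
  have r8 := rainbow_inU (isT : disjoint_seq [:: 8] [:: 9; 10]) r1y r29.
  have := rainbow_inU (isT : disjoint_seq [:: 0] [:: 8; 9; 10]) r12 r8.
  set F := _ :|: _ => rF; exists F; split=> // u; rewrite !inE -!orbA.
  have c2 : connect (adj_of F) a1 a2 by apply: con; rewrite !inE eqxx.
  have cy : connect (adj_of F) a1 y by apply: con; rewrite !inE eqxx orbT.
  case/or4P=> [|||/orP[]] /eqP-> //.
  - have [->//|xy] := eqVneq x y; apply: connect_trans cy _.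
    rewrite connect_adj_sym; apply: con.
    by rewrite !inE /Fxy (negPf xy) !inE eqxx !orbT.
  - by apply: connect_trans c2 _; apply: con; rewrite !inE eqxx !orbT.
have triple x y z : x \in K -> y \in K -> z \in K -> exists F,
    rainbow_in c [:: 0; 8; 9; 10] F /\
    [/\ connect (adj_of F) a1 x, connect (adj_of F) a1 y & connect (adj_of F) a1 z].
  move=> xK yK zK; have [N0|[n nN]] := set_0Vmem N.
    exists [set [set a1; a2]]; split.
      by apply: rainbow_in_sub r12 => d; rewrite !inE => ->.
    have c1 u : u \in K -> connect (adj_of [set [set a1; a2]]) a1 u.
      move=> uK; have := in_set0 u; rewrite -N0 inE uK andbT => /negbFE.
      by rewrite !inE => /orP[]/eqP-> //; apply: con; rewrite inE.
    by split; apply: c1.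
  (* Hubs lie on every path given by [tripleN], so a hub in the triple may be replaced by any [n] of
     [N]. *)
  pose p u := if u \in [set a1; a2] then n else u.
  have pN u : u \in K -> p u \in N.
    by move=> uK; rewrite /p; case: ifP => // u12; rewrite inE u12.
  have [F [rF cF]] := tripleN _ _ _ (pN x xK) (pN y yK) (pN z zK).
  have cp u : p u \in [set p x; p y; p z] -> connect (adj_of F) a1 u.
    move=> pu; have [u12|u12] := boolP (u \in [set a1; a2]).
      by apply: cF; rewrite -2!setUA inE u12.
    move: pu; rewrite {1}/p (negPf u12) => pu.
    by apply: cF; rewrite -2!setUA in_setU setUA pu orbT.
  by exists F; split=> //; split; apply: cp; rewrite !inE eqxx ?orbT.
move=> x y z xK yK zK; have [F [rF [cx cy cz]]] := triple x y z xK yK zK.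
exists F; rewrite connect_adj_sym in cx.
by split=> //; apply: connect_trans cx _.
Qed.

(* A profile lists the colors of three routes from a vertex to K, whose last
   edges have colors 1, 2 and 3. *)
Definition profiles : seq (seq (seq nat)) :=
  [:: [:: [:: 1]; [:: 2; 4; 5; 7]; [:: 3; 6]];
      [:: [:: 1; 6]; [:: 2; 4; 5; 7]; [:: 3]];
      [:: [:: 1; 4]; [:: 2]; [:: 3; 5; 6]];
      [:: [:: 1; 4; 6]; [:: 2]; [:: 3; 7]];
      [:: [:: 1; 4; 6]; [:: 2; 7]; [:: 3]]].

(** A finite check over the 125 ordered triples of profiles; colors 0, 8, 9 and 10 are reserved for
    linking inside [K]. *)
Lemma profiles_disjoint (p1 p2 p3 : seq (seq nat)) :
  p1 \in profiles -> p2 \in profiles -> p3 \in profiles ->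
  exists D1 D2 D3, [/\ D1 \in p1, D2 \in p2, D3 \in p3 &
    [/\ disjoint_seq [:: 0; 8; 9; 10] (D1 ++ D2 ++ D3),
        disjoint_seq D1 (D2 ++ D3) & disjoint_seq D2 D3]].
Proof.
move=> h1 h2 h3.
have /allP/(_ p1 h1)/allP/(_ p2 h2)/allP/(_ p3 h3) : all (fun p1 => all (fun p2 =>
    all (fun p3 => has (fun D1 => has (fun D2 => has (fun D3 =>
      [&& disjoint_seq [:: 0; 8; 9; 10] (D1 ++ D2 ++ D3),
          disjoint_seq D1 (D2 ++ D3) & disjoint_seq D2 D3]) p3) p2) p1)
    profiles) profiles) profiles by vm_compute.
case/hasP=> D1 D1p /hasP[D2 D2p /hasP[D3 D3p /and3P[d0 d1 d2]]].
by exists D1, D2, D3.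
Qed.

(** * Coloring of the edges not inside [K] *)

Lemma card_gt_ex (T : finType) (A B : {set T}) :
  #|B| < #|A| -> exists2 x, x \in A & x \notin B.
Proof.
move=> BA; apply/subsetPn; apply: contraL BA => /subset_leq_card.
by rewrite -leqNgt.
Qed.

(** The first profile serves non-hubs of [Q] and vertices outside [K] and [U], the second hubs, the
    third the set [S] below. The other vertices of [W] get the last two, according to whether their
    first edge to [K] has color 2 or 3. *)
Lemma outer_coloring (G : sgraph) (K Q H : {set G}) :
  (forall x : G, 3 <= #|neighbors x|) -> [set: G] \subset dominated K ->
  hub_structure K
    [set x | (x \notin K) && [exists y, (y \notin K) && sedge x y]] Q H ->
  exists oc : G -> G -> nat, [/\ forall x y, oc x y = oc y x,
    forall x y, oc x y <= 10 &
    forall k (c : {set G} -> 'I_k),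
      (forall x y, sedge x y -> ~~ ((x \in K) && (y \in K)) ->
         c [set x; y] = oc x y :> nat) ->
      forall v, exists2 p, p \in profiles & {in p, forall D, route c K v D}].
Proof.
set U := [set x | _] => deg Kdom hs.
case: (hs) => HQ QU Wdom Qhub Hspoke Huniq Qexit.
pose W := U :\: Q.
have UK u : u \in U -> u \notin K by rewrite inE => /andP[].
have QK q : q \in Q -> q \notin K by move=> qQ; apply/UK/(subsetP QU).
have WK w : w \in W -> w \notin K by case/setDP=> /UK.
have UP x y : x \notin K -> y \notin K -> sedge x y -> y \in U.
  move=> xK yK xy; rewrite inE yK; apply/existsP; exists x.
  by rewrite xK sedge_sym.
have Kex v : v \notin K -> exists2 x, x \in K & sedge v x.
  move=> vK; have := subsetP Kdom v; rewrite !inE (negPf vK) => /(_ isT).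
  by case/exists_inP=> x xK xv; exists x => //; rewrite sedge_sym.
(* [f] and [g] select a first and, if there is one, a second neighbour in [K]. *)
have /choice[f fP] v : exists x, v \notin K -> x \in K /\ sedge v x.
  have [vK|/Kex[x xK vx]] := boolP (v \in K); first by exists v.
  by exists x.
have /choice[g gP] v : exists x, 1 < #|neighbors v :&: K| ->
    [/\ x \in K, sedge v x & x != f v].
  have [lt1|] := boolP (1 < _); last by exists v.
  have [|x] := @card_gt_ex _ (neighbors v :&: K) [set f v]; first by rewrite cards1.
  by rewrite !inE => /andP[vx xK] xf; exists x.
have isoE v : v \notin K -> v \notin U -> neighbors v :&: K = neighbors v.
  move=> vK vU; apply/setIidPl/subsetP => x; rewrite inE => vx.
  by apply: contraNT vU => xK; apply: (UP x v) => //; rewrite sedge_sym.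
have [M MP] := opposite_sides W.
pose lone w := ~~ [exists x in W, sedge w x].
have loneP w x : w \in W -> x \in W -> sedge w x ->
    ~~ lone w /\ exists y, [/\ y \in W, ~~ lone y, sedge w y & (y \in M) = (w \notin M)].
  move=> wW xW wx; have [y [yW wy yM]] := MP w x wW xW wx; split.
    by rewrite /lone negbK; apply/exists_inP; exists x.
  exists y; split=> //; rewrite /lone negbK; apply/exists_inP; exists w => //.
  by rewrite sedge_sym.
(* The vertices of [W] that have neither a neighbour in [W] nor a second one in [K], hence must find
   two routes through [Q]. *)
pose S := [set w in W | lone w && (#|neighbors w :&: K| <= 1)].
have /choice[s sP] w : exists q, w \in S ->
    [/\ q \in Q, sedge w q & exists q', [/\ q' \in Q :\: H, q' != q & sedge w q']].
  have [|_] := boolP (w \in S); last by exists w.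
  rewrite inE => /and3P[wW lw le1]; have [wU _] := setDP wW.
  have NwQ : neighbors w \subset (neighbors w :&: K) :|: (neighbors w :&: Q).
    apply/subsetP => x wx; rewrite -setIUr in_setI wx in_setU; rewrite inE in wx.
    apply: contraNT lw; rewrite negb_or => /andP[xK xQ]; apply/exists_inP.
    by exists x => //; rewrite in_setD xQ; apply: (UP w) => //; apply: UK.
  have /card_gt1P[q1 [q2 []]] : 1 < #|neighbors w :&: Q|.
    have := leq_trans (deg w) (leq_trans (subset_leq_card NwQ) (leq_card_setU _ _)).
    by move/leq_trans/(_ (leq_add le1 (leqnn _))).
  rewrite !inE => /andP[wq1 q1Q] /andP[wq2 q2Q] q12.
  (* By [Huniq] at most one of [q1], [q2] is a hub. Color 5 goes to the hub if there is one, so the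
     neighbour kept for color 4 is a non-hub, with a direct edge of color 1 to [K]. *)
  have [q1H|q1H] := boolP (q1 \in H).
    exists q1 => _; split=> //; exists q2; split=> //; last by rewrite eq_sym.
    rewrite inE q2Q andbT; apply: contraNN q12 => q2H.
    by rewrite (Huniq w q1 q2).
  by exists q2 => _; split=> //; exists q1; rewrite inE q1H.
pose m1 v := if v \in Q then if v \in H then 3 else 1 else
  if v \in W then if lone v || (v \in M) then 2 else 3 else 1.
pose m2 v := if v \in W then 3 else 2.
(* The edge to [f v] gets [m1], that to [g v] gets [m2], and all further edges to [K] get 3. *)
pose leg v x := if x == f v then m1 v else if x == g v then m2 v else 3.
pose wq w q := if (w \in S) && (q == s w) then 5 else 4.
pose inner x y := if x \in Q then if y \in Q then 6 else wq y x else
  if y \in Q then wq x y else 7.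
pose oc x y := if x \in K then if y \in K then 0 else leg y x else
  if y \in K then leg x y else inner x y.
exists oc; split.
- by move=> x y; rewrite /oc /inner; do !case: ifP.
- by move=> x y; rewrite /oc /inner /leg /m1 /m2 /wq; do !case: ifP.
move=> k c cE.
have toK v x D : v \notin K -> x \in K -> sedge v x -> leg v x \in D -> route c K v D.
  move=> vK xK vx lD; apply: (@route_sub _ _ _ _ _ [:: leg v x]).
    by move=> d; rewrite inE => /eqP->.
  apply: (route_cons (v := x)) => //; last exact: route0.
  by rewrite cE ?(negPf vK) // /oc (negPf vK) xK.
have r1 v D : v \notin K -> m1 v \in D -> route c K v D.
  move=> vK mD; have [fK vf] := fP v vK; apply: toK fK vf _ => //.
  by rewrite /leg eqxx.
have r2 v D : v \notin K -> 1 < #|neighbors v :&: K| -> m2 v \in D -> route c K v D.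
  move=> vK lt1 mD; have [gK vg gf] := gP v lt1; apply: toK gK vg _ => //.
  by rewrite /leg (negPf gf) eqxx.
have via u v d D E : u \notin K -> v \notin K -> sedge u v -> inner u v = d ->
    d \notin D -> route c K v D -> {subset d :: D <= E} -> route c K u E.
  move=> uK vK uv ud dD vD DE; apply: (route_sub DE).
  have cuv : c [set u; v] = d :> nat.
    by rewrite cE ?(negPf uK) // /oc (negPf uK) (negPf vK).
  exact: route_cons uv cuv dD vD.
have WQ w : w \in W -> (w \in Q) = false by case/setDP=> _ /negPf.
have rQ1 q : q \in Q :\: H -> route c K q [:: 1].
  by move=> /setDP[qQ qH]; apply: r1; rewrite ?QK // /m1 qQ (negPf qH).
have HK h : h \in H -> h \notin K by move=> hH; apply/QK/(subsetP HQ).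
have rH3 h : h \in H -> route c K h [:: 3].
  by move=> hH; apply: r1; rewrite ?HK // /m1 (subsetP HQ) // hH.
have rH1 h : h \in H -> route c K h [:: 1; 6].
  move=> hH; have hQ := subsetP HQ h hH.
  have [q qQH hq] := Hspoke h hH; have [qQ _] := setDP qQH.
  apply: via hq _ _ (rQ1 q qQH) _; rewrite ?(HK h) ?(QK q) // /inner ?hQ ?qQ //.
  by move=> d; rewrite !inE orbC.
have rQ3 q : q \in Q :\: H -> route c K q [:: 3; 6].
  move=> qQH; have [qQ _] := setDP qQH.
  have [h hH qh] := Qhub q qQH; have hQ := subsetP HQ h hH.
  apply: via qh _ _ (rH3 h hH) _; rewrite ?(HK h) ?(QK q) // /inner ?hQ ?qQ //.
  by move=> d; rewrite !inE orbC.
have innerWQ w q : w \in W -> q \in Q -> inner w q = wq w q.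
  by move=> wW qQ; rewrite /inner (WQ w wW) qQ.
have innerQW w q : w \in W -> q \in Q -> inner q w = wq w q.
  by move=> wW qQ; rewrite /inner (WQ w wW) qQ.
have innerWW w x : w \in W -> x \in W -> inner w x = 7.
  by move=> wW xW; rewrite /inner !WQ.
have m1W w : w \in W -> m1 w = if lone w || (w \in M) then 2 else 3.
  by move=> wW; rewrite /m1 (WQ w wW) wW.
have lonePn w : w \in W -> ~~ lone w ->
    exists y, [/\ y \in W, ~~ lone y, sedge w y & (y \in M) = (w \notin M)].
  by move=> wW; rewrite /lone negbK => /exists_inP[x xW wx]; have [] := loneP w x wW xW wx.
(* If the first edge of [w] has color 3, an edge of color 7 leads to a neighbour in [M], whose first
   edge has color 2. *)
have rW2 w : w \in W -> route c K w [:: 2; 7].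
  move=> wW; have [m2w|] := boolP (lone w || (w \in M)).
    by apply: r1; rewrite ?WK // m1W // m2w.
  rewrite negb_or => /andP[lw wM]; have [y [yW ly wy yM]] := lonePn w wW lw.
  apply: via wy (innerWW _ _ wW yW) _ (r1 y [:: 2] (WK y yW) _) _; rewrite ?WK //.
    by rewrite m1W // yM wM orbT.
  by move=> d; rewrite !inE orbC.
(* A lone vertex outside [S] has a second edge to [K], of color 3; otherwise [w] or a neighbour on
   the other side of [M] has a first edge of color 3. *)
have rW3 w : w \in W -> w \notin S -> route c K w [:: 3; 7].
  move=> wW; rewrite inE wW /=; have [lw /=|lw _] := boolP (lone w).
    by rewrite -ltnNge => lt1; apply: r2; rewrite ?WK // /m2 wW.
  have [y [yW ly wy yM]] := lonePn w wW lw; have [wM|wM] := boolP (w \in M).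
    apply: via wy (innerWW _ _ wW yW) _ (r1 y [:: 3] (WK y yW) _) _; rewrite ?WK //.
      by rewrite m1W // (negPf ly) yM wM.
    by move=> d; rewrite !inE orbC.
  by apply: r1; rewrite ?WK // m1W // (negPf lw) (negPf wM).
(* Either a second edge to [K] has color 2, or an edge of color 4 or 5 enters [W], where [rW2]
   continues. *)
have rQ2 q : q \in Q -> route c K q [:: 2; 4; 5; 7].
  move=> qQ; case: (Qexit q qQ) => [[w wW qw]|lt1]; last first.
    by apply: r2; rewrite ?QK // /m2 in_setD qQ.
  apply: via qw (innerQW _ _ wW qQ) _ (rW2 w wW) _; rewrite ?(QK q) ?(WK w) // /wq.
    by case: ifP.
  by move=> d; rewrite !inE; case: ifP => _; case/or3P=> ->; rewrite ?orbT.
have rW1 w : w \in W -> w \notin S -> route c K w [:: 1; 4; 6].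
  move=> wW wS; have [q qQ wq'] := Wdom w wW.
  have e4 : inner w q = 4 by rewrite innerWQ // /wq (negPf wS).
  have [qH|qH] := boolP (q \in H).
    apply: via wq' e4 _ (rH1 q qH) _; rewrite ?(QK q) ?(WK w) //.
    by move=> d; rewrite !inE orbCA.
  have qQH : q \in Q :\: H by rewrite inE qH.
  apply: via wq' e4 _ (rQ1 q qQH) _; rewrite ?(QK q) ?(WK w) //.
  by move=> d; rewrite !inE => /orP[]->; rewrite ?orbT.
move=> v; have [vK|vK] := boolP (v \in K).
  (* Any profile would do: the empty route serves every list of colors. *)
  by exists (nth [::] profiles 0) => // D _; apply: route0.
have [vU|vU] := boolP (v \in U); last first.
  have Nv := isoE v vK vU; have lt1 : 1 < #|neighbors v :&: K|.
    by rewrite Nv (leq_trans _ (deg v)).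
  have vQ : v \in Q = false by apply: contraNF vU => /(subsetP QU).
  have vW : v \in W = false by rewrite inE (negPf vU) andbF.
  exists (nth [::] profiles 0) => //= D; rewrite !inE => /or3P[]/eqP->.
  - by apply: r1; rewrite // /m1 vQ vW.
  - by apply: r2; rewrite // /m2 vW.
  (* All neighbours of [v] lie in [K], and there are at least three, so one differs from [f v] and
     [g v]; its edge has color 3. *)
  have [|x] := @card_gt_ex _ (neighbors v :&: K) [set f v; g v].
    by rewrite Nv (leq_trans _ (deg v)) // cards2; case: (_ != _).
  rewrite !inE negb_or => /andP[vx xK] /andP[xf xg].
  by apply: toK xK vx _; rewrite // /leg (negPf xf) (negPf xg).
have [vQ|vQ] := boolP (v \in Q).
  have [vH|vH] := boolP (v \in H).
    exists (nth [::] profiles 1) => //= D; rewrite !inE => /or3P[]/eqP->.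
    - exact: rH1.
    - exact: rQ2.
    - exact: rH3.
  have vQH : v \in Q :\: H by rewrite inE vQ vH.
  exists (nth [::] profiles 0) => //= D; rewrite !inE => /or3P[]/eqP->.
  - exact: rQ1.
  - exact: rQ2.
  - exact: rQ3.
have vW : v \in W by rewrite inE vQ.
have [vS|vS] := boolP (v \in S).
  have [sQ vs [q [qQH qs vq]]] := sP v vS; have [qQ qH] := setDP qQH.
  have es : inner v (s v) = 5 by rewrite innerWQ // /wq vS eqxx.
  have eq : inner v q = 4 by rewrite innerWQ // /wq (negPf qs) andbF.
  exists (nth [::] profiles 2) => //= D; rewrite !inE => /or3P[]/eqP->.
  - apply: via vq eq _ (rQ1 q qQH) _; rewrite ?(QK q) //.
    by move=> d; rewrite !inE orbC.
  - apply: r1; rewrite // m1W //; move: vS; by rewrite inE => /and3P[_ -> _].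
  - have [sH|sH] := boolP (s v \in H).
      apply: via vs es _ (rH3 _ sH) _; rewrite ?(QK (s v)) //.
      by move=> d; rewrite !inE => /orP[]->; rewrite ?orbT.
    have sQH : s v \in Q :\: H by rewrite inE sH.
    apply: via vs es _ (rQ3 _ sQH) _; rewrite ?(QK (s v)) //.
    by move=> d; rewrite !inE orbCA.
have [m2v|m2v] := boolP (lone v || (v \in M)).
  exists (nth [::] profiles 3) => //= D; rewrite !inE => /or3P[]/eqP->.
  - exact: rW1.
  - by apply: r1; rewrite // m1W // m2v.
  - exact: rW3.
exists (nth [::] profiles 4) => //= D; rewrite !inE => /or3P[]/eqP->.
- exact: rW1.
- exact: rW2.
- by apply: r1; rewrite // m1W // (negPf m2v).
Qed.

(** * The two upper bounds and the final estimate *)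

(** A spanning tree whose edges are colored by their positions in an enumeration is rainbow and
    contains every triple. *)
Lemma rainbow3_colorable_spanning (G : sgraph) :
  connected G -> 1 < #|G| -> rainbow3_colorable G #|G|.-1.
Proof.
case=> /set0Pn[x _] Gc G1; pose m := #|G|.-2.
have mE : #|G|.-1 = m.+1 by rewrite /m; lia.
have [V [F [tF _ ltF VF]]] := subtree_reach x (subxx (edges G)).
have VT u : u \in V.
  by apply: VF; rewrite (eq_connect (@adj_of_edges G)); apply: Gc.
have idx e : e \in F -> index e (enum F) < m.+1.
  move=> eF; have : index e (enum F) < #|F| by rewrite cardE index_mem mem_enum.
  by have /(leq_trans ltF) := max_card (mem V); rewrite -mE; lia.
rewrite mE; exists (fun e => inord (index e (enum F))) => S _.
exists V, F; split; last by apply/subsetP => u _; apply: VT.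
split=> // e e' eF e'F /(congr1 val); rewrite /= !inordK ?idx // => E.
by rewrite -(nth_index set0 (_ : e \in enum F)) ?mem_enum // E nth_index ?mem_enum.
Qed.

Lemma min_degree_le (G : sgraph) (x : G) : min_degree G <= degree x.
Proof.
rewrite /min_degree; have : x \in index_enum G by rewrite mem_index_enum.
elim: (index_enum G) => // y s IHs; rewrite inE big_cons geq_min.
by case/orP=> [/eqP->|/IHs->]; rewrite ?leqnn ?orbT.
Qed.

Lemma rainbow3_colorable11 (G : sgraph) :
  connected G -> ~ induced_subgraph P5 G -> ~ induced_subgraph C5 G ->
  (forall x : G, 3 <= #|neighbors x|) -> rainbow3_colorable G 11.
Proof.
case=> G0 Gc noP5 noC5 deg.
have [A _ /set0Pn[x xA] AT|K [cK K0 _ Kdom]] := dominating_clique noP5 noC5 G0.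
  have [y _ yA] : exists2 y, y \in [set: G] & y \notin A.
    by apply/subsetPn; apply: contraNN AT => TA; rewrite eqEsubset subsetT.
  have [u [v [uA vA uv]]] := connect_exit (Gc x y (in_setT x) (in_setT y)) xA yA.
  by exists u, v; rewrite inE vA inE.
have [Q [H hs]] := hub_structure_exists K noP5 noC5 deg.
have [oc [ocC oc10 ocP]] := outer_coloring deg Kdom hs.
have [kc [kcC kc10 kcP]] := clique_coloring cK K0.
(* The two colorings share no edge: [kc] acts inside [K], [oc] everywhere else. *)
pose cc x y := if (x \in K) && (y \in K) then kc x y else oc x y.
have ccC x y : cc x y = cc y x by rewrite /cc andbC kcC ocC.
have cE x y : edge_color 10 cc [set x; y] = cc x y :> nat.
  by apply: edge_colorE => //; rewrite /cc; case: ifP.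
have Klink : linked (edge_color 10 cc) K [:: 0; 8; 9; 10].
  by apply: kcP => x y xK yK _; rewrite cE /cc xK yK.
have prof : forall v, exists2 p, p \in profiles &
    {in p, forall D, route (edge_color 10 cc) K v D}.
  by apply: ocP => x y _ xyK; rewrite cE /cc (negPf xyK).
exists (edge_color 10 cc) => S S3.
have SE u : u \in enum S = (u \in S) by rewrite mem_enum.
move: S3; rewrite cardE; case: (enum S) SE => [|x1 [|x2 [|x3 [|]]]] // SE _.
have [p1 p1P r1] := prof x1; have [p2 p2P r2] := prof x2.
have [p3 p3P r3] := prof x3.
have [D1 [D2 [D3 [D1p D2p D3p [d0 d1 d2]]]]] := profiles_disjoint p1P p2P p3P.
have [V [F [tF SV]]] := rainbow_tree_of_routes Klink (r1 _ D1p) (r2 _ D2p) (r3 _ D3p) d0 d1 d2.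
exists V, F; split=> //; apply: subset_trans SV; apply/subsetP => u.
by rewrite -SE !inE orbA.
Qed.

Local Open Scope ring_scope.

Theorem theorem3p4 (G : sgraph) (connG : connected G)
  (P5_free : ~ induced_subgraph P5 G)
  (C5_free : ~ induced_subgraph C5 G)
  (min_deg : (3 <= min_degree G)%N) :
  (rx3 connG)%:R <= 11%:R / 16%:R * #|G|%:R + 3%:R :> rat.
Proof.
have deg (x : G) : (3 <= #|neighbors x|)%N.
  exact: leq_trans min_deg (min_degree_le x).
have [x _] : exists x, x \in [set: G] by apply/set0Pn; case: connG.
have G3 : (3 <= #|G|)%N by apply: leq_trans (deg x) (max_card _).
have rxle k : rainbow3_colorable G k -> (rx3 connG <= k)%N.
  by move=> Gk; rewrite /rx3; case: ex_minnP => m _; apply; apply/asboolP.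
(* Denominators are cleared by 16. The bound 11 suffices from order 12 on, since 176 <= 11n + 48
   there; the bound n - 1 suffices up to order 12, since 5n <= 64 there. *)
have le16 : (16 * rx3 connG <= 11 * #|G| + 48)%N.
  have := rxle _ (rainbow3_colorable11 connG P5_free C5_free deg).
  have := rxle _ (rainbow3_colorable_spanning connG (ltnW G3)).
  lia.
have : (16 * rx3 connG)%:R <= (11 * #|G| + 48)%:R :> rat by rewrite ler_nat.
rewrite natrD !natrM; lra.
Qed.
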